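(* Let $m,k,n$ be integers with $2\le m+2\le k<n$ and $2k\le n+m$. For $T\in\mathrm{SYT}((n-k+m,k)/(m))$, define $\mathrm{cDes}_P(T)\subseteq[n]$ by $\mathrm{cDes}_P(T)\cap[n-1]=\mathrm{Des}(T)$ and by letting $n\in\mathrm{cDes}_P(T)$ if and only if at least one of the following conditions holds, where $b=b(T)$: (1) $1$ is lower than $n$ in $T$ (i.e. $1$ is in the second row and $n$ is in the first row); (2) $1$ is in the first row, $b>m$, and for every $1\le i\le k-b-1$ we have $T_{2,i}>T_{1,i+m+1}$; (3) $1$ is in the second row and $b>m$; (4) $1$ is in the second row, $b\le m$, and there exists some $m-b+1\le i\le k-b-1$ such that $T_{2,i}<T_{1,i+b}$. Then $\mathrm{cDes}_P$ is a cyclic descent map for $(n-k+m,k)/(m)$.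
   Context: Let $[n]=\{1,\dots,n\}$. Tableaux are drawn in English notation (row 1 on top), and $T_{i,j}$ is the entry in row $i$ and column $j$; in the skew shape $(n-k+m,k)/(m)$ the first row occupies columns $m+1,\dots,n-k+m$ and the second row occupies columns $1,\dots,k$. For a skew shape $\lambda/\mu$ with $n$ cells, $\mathrm{SYT}(\lambda/\mu)$ is the set of standard Young tableaux of that shape; $\mathrm{Des}(T)=\{i\in[n-1]: i+1\text{ is in a lower row than } i\text{ in }T\}$. For $T\in\mathrm{SYT}((n-k+m,k)/(m))$, $b(T)\ge0$ is the number of consecutive entries at the end of the second row of $T$ minus one; that is, the largest $b$ such that the second row of $T$ ends in $i-b,\dots,i-1,i$ for some $i$. A cyclic descent map for $\lambda/\mu$ is a map $\mathrm{cDes}:\mathrm{SYT}(\lambda/\mu)\to 2^{[n]}$ such that (i) $\mathrm{cDes}(T)\cap[n-1]=\mathrm{Des}(T)$ for every $T$; and (ii) the multiset $\{\!\{\mathrm{cDes}(T):T\in\mathrm{SYT}(\lambda/\mu)\}\!\}$ is invariant under replacing each set $D$ by $1+D$ (adding $1$ modulo $n$ to each element). *)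

(* Defs.v *)
From HB Require Import structures.
From mathcomp Require Import all_boot.

Set Implicit Arguments.
Unset Strict Implicit.
Unset Printing Implicit Defensive.

(* Rows, columns and entries are numbered from 1. An element x of 'I_n stands
   for the element x.+1 of [n] = {1, ..., n}, so that ordS, the cyclic
   successor on 'I_n, is the addition of 1 modulo n on [n]. *)

Section Tableaux.

Variables (la mu : seq nat) (n : nat).

Definition skew_cells : seq (nat * nat) :=
  [seq (i, j) | i <- iota 1 (size la),
                j <- iota (nth 0 mu i.-1).+1 (nth 0 la i.-1 - nth 0 mu i.-1)].

Definition cell := seq_sub skew_cells.

Definition row (c : cell) : nat := (val c).1.
Definition col (c : cell) : nat := (val c).2.

Definition is_standard (f : {ffun cell -> 'I_n}) : bool :=
  [&& [forall e : 'I_n, #|[set c | f c == e]| == 1],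
      [forall c : cell, forall d : cell,
         (row c == row d) && (col c < col d) ==> (f c < f d)]
    & [forall c : cell, forall d : cell,
         (col c == col d) && (row c < row d) ==> (f c < f d)]].

(* Every element of 'I_n is used exactly once, so this type is empty unless
   n is the number of cells of la / mu. *)
Definition SYT := {f : {ffun cell -> 'I_n} | is_standard f}.
HB.instance Definition _ := Finite.on SYT.

(* T_{i,j}, with the junk value 0 outside the shape *)
Definition entry (T : SYT) (i j : nat) : nat :=
  if insub (i, j) : option cell is Some c then (val T c).+1 else 0.

(* the row containing e, with the junk value 0 unless 1 <= e <= n *)
Definition row_of (T : SYT) (e : nat) : nat :=
  if [pick c : cell | (val T c).+1 == e] is Some c then row c else 0.

(* English notation: lower rows have larger indices. *)
Definition lower (T : SYT) (a b : nat) : bool := row_of T b < row_of T a.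

Definition Des (T : SYT) : {set 'I_n} :=
  [set i : 'I_n | (i.+1 < n) && lower T i.+2 i.+1].

Definition shift (D : {set 'I_n}) : {set 'I_n} := [set ordS i | i in D].

Definition cyclic_descent_map (cDes : SYT -> {set 'I_n}) : Prop :=
  (forall T : SYT, cDes T :&: [set i : 'I_n | i.+1 < n] = Des T) /\
  perm_eq [seq cDes T | T : SYT] [seq shift (cDes T) | T : SYT].

End Tableaux.

Section TwoRows.

Variables n k m : nat.

Definition SYT2 := SYT [:: n - k + m; k] [:: m] n.

Implicit Type T : SYT2.

Definition b_of T : nat :=
  \max_(b < k | [forall t : 'I_b.+1, entry T 2 (k - t) + t == entry T 2 k]) b.

Definition cond1 T : bool := lower T 1 n.

Definition cond2 T : bool :=
  [&& row_of T 1 == 1, m < b_of T &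
      [forall i : 'I_k, (1 <= i <= k - b_of T - 1) ==>
         (entry T 2 i > entry T 1 (i + m + 1))]].

Definition cond3 T : bool := (row_of T 1 == 2) && (m < b_of T).

Definition cond4 T : bool :=
  [&& row_of T 1 == 2, b_of T <= m &
      [exists i : 'I_k, (m - b_of T + 1 <= i <= k - b_of T - 1) &&
         (entry T 2 i < entry T 1 (i + b_of T))]].

Definition cDesP T : {set 'I_n} :=
  Des T :|: [set i : 'I_n | (i.+1 == n) &&
                            [|| cond1 T, cond2 T, cond3 T | cond4 T]].

End TwoRows.

(* The shape (n-k+m, k) / (m) has n cells, so SYT2 uses the right n. *)
Lemma size_skew_cells2 n k m :
  k <= n -> size (skew_cells [:: n - k + m; k] [:: m]) = n.
Proof.
by move=> kn; rewrite /skew_cells /= !size_cat !size_map !size_iota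
                      subn0 addnK addn0 subnK.
Qed.

(* Main.v *)
Require Import Defs.
From mathcomp Require Import all_boot zify.

(** A standard tableau of shape (n-k+m, k)/(m) is read as a word of length n
    recording the row of each entry: [true] for the second row, [false] for the
    first. As a lattice path starting at height m, with [true] a down step and
    [false] an up step, the word ends after k down steps, and the column
    condition says that the path never goes below 0. Descents are the peaks, an
    up step followed by a down step ([word_of], [word_of_perm_eq]).

    For the set of all words of length n with a given number of down steps,
    reading the peaks cyclically gives sets that turn with the word, so their
    multiset is invariant under the shift ([cyclic_peaks_shift]). The theorem
    is deduced from this invariance and from an identity of multisets,
    [ballot_perm_eq]: the sets cDes(T), together with the cyclic peak sets of
    all words with k-m-1 down steps, are the cyclic peak sets of all words with
    k down steps. This is the Jacobi-Trudi formula
    s = h_(n-k) h_k - h_(n-k+m+1) h_(k-m-1), refined by cyclic descents; since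
    two of the three multisets are shift-invariant, so is the third.

    The identity is proved for one ordinary peak set at a time. Between two
    consecutive peaks all down steps precede all up steps, so a word with given
    peaks amounts to the number a_t <= x_t of down steps in each gap, of length
    x_t ([block_word]). Deleting the peaks does not change the minimum of the
    path, so the condition of staying nonnegative bears on a path made of
    unconstrained pieces: a_t steps down, then x_t - a_t steps up. For such
    paths the reflection principle holds ([reflection]): those starting at h
    that go below 0 are as many as those with h+1 fewer down steps. With h = m
    this settles the identity when n is ignored.

    It remains to count the words for which n is a cyclic descent. The first
    gap x and the last gap y are then kept apart. The conditions (1)-(4) say
    that the path starts with an up step, ends its descents by a run longer
    than m+1 and stays above m before that run (condition (2)), or that it
    starts with a down step and does not both end with a down step and stay at
    height at least b before its last run (conditions (1), (3), (4)). Each of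
    these constraints is again that of a path from a lower starting point, so
    reflection evaluates each count as a difference of sums of one function
    over windows of consecutive integers, and the windows cancel
    ([wrap_count]). *)

Set Implicit Arguments.
Unset Strict Implicit.
Unset Printing Implicit Defensive.

Implicit Types (w : seq bool) (l s : seq nat).

(** * Sums over windows of consecutive integers *)

Definition window_sum (F : nat -> nat) c p := \sum_(i < p) F (c + i).

Lemma window_sumD F c p q :
  window_sum F c (p + q) = window_sum F c p + window_sum F (c + p) q.
Proof.
rewrite /window_sum big_split_ord /=; congr (_ + _).
by apply: eq_bigr => i _; rewrite addnA.
Qed.

Lemma window_sum_rev F c p : \sum_(i < p) F (c + p.-1 - i) = window_sum F c p.
Proof.
rewrite /window_sum (reindex_inj rev_ord_inj); apply: eq_bigr => i _ /=.
by congr F; have := ltn_ord i; lia.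
Qed.

(** Two windows of length p at distance q. If q < p they overlap, and both sides
    add up to the window of length p + q; otherwise both sides are the same two
    windows. The short sum on the right runs backwards, as the terms produced
    by reflection do. *)
Lemma window_sum_swap F c p q :
  window_sum F c (minn p q) + window_sum F (c + q) p =
  \sum_(i < minn p q) F (c + (p + q).-1 - i) + window_sum F c p.
Proof.
have -> : \sum_(i < minn p q) F (c + (p + q).-1 - i)
          = window_sum F (c + maxn p q) (minn p q).
  rewrite -window_sum_rev; apply: eq_bigr => i _; congr F.
  by have := ltn_ord i; lia.
case: (leqP p q) => [//|/ltnW qp]; first by rewrite addnC.
have := window_sumD F c q (p - q); have := window_sumD F (c + q) (p - q) q.
rewrite subnK // subnKC //; have -> : c + q + (p - q) = c + p by lia.
lia.
Qed.

Lemma sum_ord_minn (F : nat -> nat) p q :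
  \sum_(i < p | i < q) F i = \sum_(i < minn p q) F i.
Proof.
rewrite (big_ord_widen _ _ (geq_minl p q)).
by apply: eq_bigl => i; have := ltn_ord i; lia.
Qed.

(** * Bounded sequences and the reflection principle *)

(** An entry of [l] is the length of a gap between consecutive peaks, and the
    corresponding entry of a choice is the number of down steps in that gap. *)
Fixpoint choices (l : seq nat) : seq (seq nat) :=
  if l is x :: l' then [seq i :: s | i <- iota 0 x.+1, s <- choices l']
  else [:: [::]].

Lemma choices_cons x l :
  choices (x :: l) = [seq i :: s | i <- iota 0 x.+1, s <- choices l].
Proof. by []. Qed.

Lemma mem_choices l s : (s \in choices l) = all2 leq s l.
Proof.
elim: l s => [|x l IH] [|i s]; rewrite ?choices_cons //.
  by apply/negbTE/negP => /allpairsPdep[i [t [_ _]]].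
rewrite [RHS]/= -IH.
apply/allpairsPdep/andP => [[j [t [Hj Ht [-> ->]]]]|[Hi Hs]].
  by rewrite mem_iota in Hj; split => //; lia.
by exists i, s; split => //; rewrite mem_iota; lia.
Qed.

Lemma uniq_choices l : uniq (choices l).
Proof.
elim: l => [|x l IH] //; apply: allpairs_uniq_dep => //.
  by rewrite iota_uniq.
by move=> [i s] [j t] _ _ /= [-> ->].
Qed.

Lemma count_choices_cons P x l :
  count P (choices (x :: l)) =
  \sum_(i < x.+1) count (fun s => P ((i : nat) :: s)) (choices l).
Proof.
rewrite -(big_mkord xpredT (fun i => count (fun s => P (i :: s)) (choices l))).
rewrite /index_iota subn0 choices_cons.
elim: (iota _ _) => [|i r IH]; first by rewrite big_nil.
by rewrite big_cons /= count_cat IH count_map.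
Qed.

Lemma count_choices_rcons P l y :
  count P (choices (rcons l y)) =
  \sum_(j < y.+1) count (fun s => P (rcons s (j : nat))) (choices l).
Proof.
elim: l P => [|x l IH] P.
  by rewrite count_choices_cons; apply: eq_bigr => j _.
rewrite rcons_cons count_choices_cons.
under eq_bigr do rewrite IH.
rewrite exchange_big /=; apply: eq_bigr => j _.
exact/esym/(count_choices_cons (fun s => P (rcons s (j : nat)))).
Qed.

(** The path from height [h] that goes through the gaps in turn, first down by
    [i] and then up by [x - i], has its local minima after the down steps. *)
Fixpoint valleys_ok (l s : seq nat) h :=
  match l, s with
  | x :: l', i :: s' => (i <= h) && valleys_ok l' s' (h - i + (x - i))
  | _, _ => true
  end.

Lemma valleys_ok_leq l s h h' :
  h <= h' -> valleys_ok l s h -> valleys_ok l s h'.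
Proof.
elim: l s h h' => [|x l IH] [|i s] //= h h' hh' /andP[ih].
move=> /(IH _ _ (h' - i + (x - i))) ->; lia.
Qed.

(** The height reached after the gaps [l] is h + sumn l - 2 sumn s, which is
    nonnegative as soon as the valleys are. *)
Lemma valleys_ok_rcons l y s j h : s \in choices l ->
  valleys_ok (rcons l y) (rcons s j) h =
  valleys_ok l s h && (j + 2 * sumn s <= h + sumn l).
Proof.
rewrite mem_choices; elim: l s h => [|x l IH] [|i s] //= h => [_|/andP[ix /IH->]].
  by rewrite andbT muln0 !addn0.
by case: leqP => //= ih; congr andb; lia.
Qed.

Section Reflection.
Variable k : nat.

(** The offset [c] is added to the total instead of being subtracted from [k]:
    totals that would be negative then count no sequence. *)
Definition all_count l c := count (fun s => sumn s + c == k) (choices l).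
Definition nonneg_count l h c :=
  count (fun s => (sumn s + c == k) && valleys_ok l s h) (choices l).

Lemma all_count_cons x l c :
  all_count (x :: l) c = window_sum (all_count l) c x.+1.
Proof.
rewrite /all_count count_choices_cons; apply: eq_bigr => i _.
by apply: eq_count => s /=; lia.
Qed.

Lemma all_count_rcons l y c :
  all_count (rcons l y) c = window_sum (all_count l) c y.+1.
Proof.
rewrite /all_count count_choices_rcons; apply: eq_bigr => i _.
by apply: eq_count => s /=; rewrite sumn_rcons; lia.
Qed.

Lemma nonneg_count_cons x l h c :
  nonneg_count (x :: l) h c =
  \sum_(i < minn x.+1 h.+1) nonneg_count l (h + x - i.*2) (c + i).
Proof.
rewrite /nonneg_count count_choices_cons.
rewrite -(sum_ord_minn (fun i => nonneg_count l (h + x - i.*2) (c + i))).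
rewrite [RHS]big_mkcond /=; apply: eq_bigr => i _.
have ix := ltn_ord i.
rewrite ltnS; case: (leqP i h) => ih /=.
  apply: eq_count => s /=.
  have -> : h - i + (x - i) = h + x - i.*2 by lia.
  by congr andb; lia.
by rewrite (eq_count (a2 := pred0)) ?count_pred0 // => s; rewrite andbF.
Qed.

(** Reflection across height -1. The hypothesis says that a path with k - c down
    steps ends at height -1 or more; hence each path from -h-2 to the same end
    meets -1, and the paths that meet -1 match those with h+1 fewer down steps.
    The induction removes the first gap, where the reflected terms are a window
    read backwards. *)
Lemma reflection l h c : 2 * k <= h + sumn l + 2 * c + 1 ->
  nonneg_count l h c + all_count l (c + h.+1) = all_count l c.
Proof.
elim: l h c => [|x l IH] h c H.
  rewrite /nonneg_count /all_count /=.
  by move: H; rewrite /= ; case: (_ =P k); case: (_ =P k); lia.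
rewrite nonneg_count_cons !all_count_cons.
have := window_sum_swap (all_count l) c x.+1 h.+1.
suff : \sum_(i < minn x.+1 h.+1) nonneg_count l (h + x - i.*2) (c + i) +
       \sum_(i < minn x.+1 h.+1) all_count l (c + (x.+1 + h.+1).-1 - i)
   = window_sum (all_count l) c (minn x.+1 h.+1) by lia.
rewrite -big_split; apply: eq_bigr => i _ /=.
have iM := ltn_ord i.
rewrite -(IH (h + x - i.*2) (c + i)); last by move: H => /=; lia.
by congr (_ + all_count l _); lia.
Qed.
End Reflection.

(** * Counting the cyclic descent at the last letter *)

Section WrapCount.
Variables (k m x y r : nat) (l : seq nat).
Hypothesis long : 2 * k <= m + (x + sumn l + y) + 2 * r.

(** The first gap [x] and the last gap [y] carry the first and last letters,
    which decide whether the last letter is a cyclic descent; [l] collects the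
    other gaps. *)
Definition ends_count (Q : nat -> nat -> pred (seq nat)) :=
  \sum_(i < x.+1) \sum_(j < y.+1) count (Q i j) (choices l).

Lemma count_choices_ends P :
  count P (choices (x :: rcons l y)) =
  ends_count (fun i j s => P (i :: rcons s j)).
Proof.
rewrite count_choices_cons; apply: eq_bigr => i _.
exact: (count_choices_rcons (fun s => P ((i : nat) :: s))).
Qed.

(** The conditions (1)-(4) for the word with [i] down steps in its first gap and
    [j] in its last one; the peak before the last gap adds one down step to the
    last run, so b = j. If i = 0 the word starts with an up step and condition
    (2) asks the path to stay above m after it; for x = 0 it falls back to m at
    once. If i > 0, then [j < y] is condition (1); conditions (3) and (4) merge,
    for when m < j the truncated m - j is 0, and a path that goes down from
    height 0 is not nonnegative. *)
Definition wrap_choice i j s :=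
  if i is 0 then [&& m < j, 0 < x & valleys_ok l s x.-1]
  else (j < y) || ~~ valleys_ok (x :: l) (i :: s) (m - j).

Let f := all_count k l.
Let F := all_count k (rcons l y).

(** Leaving out j = y from a sum over the last gap removes one value of [f] for
    each [i]. *)
Lemma wrap_peak_ends_count c :
  ends_count (fun i j s => (i + sumn s + j + c == k) && ((0 < i) && (j < y)))
  + window_sum f (c + y.+1) x = window_sum F c.+1 x.
Proof.
rewrite /ends_count big_ord_recl big1 ?add0n => [|j _]; last first.
  by rewrite (eq_count (a2 := pred0)) ?count_pred0 // => s; rewrite andbF.
rewrite -big_split; apply: eq_bigr => i _ /=.
rewrite /F all_count_rcons [RHS]/window_sum !big_ord_recr /=.
rewrite [X in _ + X + _](eq_count (a2 := pred0)); last by move=> s /=; lia.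
rewrite count_pred0 addn0; congr (_ + f _); last by rewrite /bump; lia.
apply: eq_bigr => j _; apply: eq_count => s /=.
by have := ltn_ord j; rewrite /bump; lia.
Qed.

(** A path that stays above m before a last run of more than m + 1 down steps
    becomes, when lowered by m + 1 and deprived of m + 1 steps of that run, an
    arbitrary nonnegative path whose last gap is shorter by m + 1. *)
Lemma first_run_empty_shift : 0 < x -> m < y ->
   \sum_(j < y.+1)
    count (fun s => [&& 0 + sumn s + j + r == k,
      valleys_ok (x :: rcons l y) (0 :: rcons s j) m & wrap_choice 0 j s])
      (choices l)
  = nonneg_count k (rcons l (y - m.+1)) x.-1 (m.+1 + r).
Proof.
move=> x0 my; rewrite /nonneg_count count_choices_rcons.
have -> : y.+1 = m.+1 + (y - m.+1).+1 by lia.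
rewrite big_split_ord /= big1 ?add0n => [|j _]; last first.
  rewrite (eq_count (a2 := pred0)) ?count_pred0 // => s.
  by rewrite /=; have := ltn_ord j; lia.
apply: eq_bigr => j _; apply: eq_in_count => s sl /=.
rewrite !valleys_ok_rcons // sumn_rcons.
have H := @valleys_ok_leq l s x.-1 (m - 0 + (x - 0)).
have := ltn_ord j; lia.
Qed.

Lemma first_run_empty_count :
   \sum_(j < y.+1)
    count (fun s => [&& 0 + sumn s + j + r == k,
      valleys_ok (x :: rcons l y) (0 :: rcons s j) m & wrap_choice 0 j s])
      (choices l)
  + window_sum f (m.+1 + r + x) (y - m) = window_sum f (m.+1 + r) (y - m).
Proof.
have [x0|x0] := posnP x.
  rewrite big1 => [|j _]; first by rewrite x0 addn0.
  by rewrite (eq_count (a2 := pred0)) ?count_pred0 // => s /=; lia.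
have [ym|my] := leqP y m.
  rewrite big1 => [|j _]; first by rewrite (eqP ym) /window_sum !big_ord0.
  rewrite (eq_count (a2 := pred0)) ?count_pred0 // => s /=.
  by have := ltn_ord j; lia.
rewrite (first_run_empty_shift x0 my).
have := @reflection k (rcons l (y - m.+1)) x.-1 (m.+1 + r).
rewrite !all_count_rcons sumn_rcons prednK //.
have -> : (y - m.+1).+1 = y - m by lia.
by apply; lia.
Qed.

(** Counted by complement. Among the nonnegative paths that start with i > 0
    down steps, those excluded by [wrap_choice] have j = y and stay at height at
    least y before the last gap: they are the paths through the other gaps from
    a starting height lowered by y. Their last valley is nonnegative because
    the path ends there and [long] makes the final height nonnegative. *)
Lemma first_run_nonempty_count i : 0 < i <= x ->
   \sum_(j < y.+1)
    count (fun s => [&& i + sumn s + j + r == k,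
      valleys_ok (x :: rcons l y) (i :: rcons s j) m & wrap_choice i j s])
      (choices l)
  + (if i <= m - y then nonneg_count k l (m - y + x - i.*2) (i + y + r) else 0)
  = if i <= m then nonneg_count k (rcons l y) (m + x - i.*2) (i + r) else 0.
Proof.
case: i => // i /= ix.
have [mi|im] := ltnP m i.+1.
  have -> : (i < m - y) = false by lia.
  rewrite big1 // => j _.
  by rewrite (eq_count (a2 := pred0)) ?count_pred0 // => s /=; lia.
rewrite /nonneg_count count_choices_rcons !big_ord_recr /= -addnA; congr (_ + _).
  apply: eq_bigr => j _; apply: eq_count => s /=.
  rewrite sumn_rcons (ltn_ord j) andbT /=.
  have -> : m - i.+1 + (x - i.+1) = m + x - i.+1.*2 by lia.
  by congr andb; lia.
set P1 := (P1 in count P1 _ + _); set P3 := (P3 in _ = count P3 _).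
(* P2 selects the excluded paths: all of the last gap goes down, and the
   path stays at height at least y before it. *)
pose P2 := fun s => P3 s && ((i < m - y) && valleys_ok l s (m - y - i.+1 + (x - i.+1))).
have -> : (if i < m - y then
   count (fun s => (sumn s + (i.+1 + y + r) == k) && valleys_ok l s (m - y + x - i.+1.*2))
     (choices l) else 0) = count P2 (choices l).
  case: ifP => H; last first.
    by rewrite (eq_count (a2 := pred0)) ?count_pred0 // => s; rewrite /P2 H andbF.
  apply: eq_in_count => s sl; rewrite /P2 /P3 /= H valleys_ok_rcons // sumn_rcons.
  have -> : m - y - i.+1 + (x - i.+1) = m - y + x - i.+1.*2 by lia.
  have := @valleys_ok_leq l s (m - y + x - i.+1.*2) (m + x - i.+1.*2).
  case: (valleys_ok _ _ (m - y + x - i.+1.*2)); last by rewrite !andbF.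
  move=> -> //; last lia.
  move: long; lia.
rewrite -(count_predUI P1 P2).
rewrite [X in _ + X](eq_count (a2 := pred0)); last first.
  move=> s; rewrite /= /P1 /P2 ltnn /=.
  by case: (valleys_ok l s _); rewrite ?andbF //; lia.
rewrite count_pred0 addn0; apply: eq_count => s /=.
rewrite /P1 /P2 /P3 ltnn /= sumn_rcons.
have -> : m - i.+1 + (x - i.+1) = m + x - i.+1.*2 by lia.
case: (valleys_ok (rcons l y) _ _); rewrite ?andbF //=.
by case: (valleys_ok l s _); lia.
Qed.

(** Summing [reflection] over the number of down steps of the first gap. The
    indices beyond [h] contribute no path, and [window_sum_swap] turns the
    truncated sums into full windows. *)
Lemma reflection_sum l' h c : 2 * k <= h + x + sumn l' + 2 * c ->
  \sum_(i < x) (if i < h then nonneg_count k l' (h + x - i.+1.*2) (i.+1 + c) else 0)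
  + window_sum (all_count k l') (c + h).+1 x = window_sum (all_count k l') c.+1 x.
Proof.
move=> H; rewrite -big_mkcond /=.
rewrite (sum_ord_minn (fun i => nonneg_count k l' (h + x - i.+1.*2) (i.+1 + c))).
have := window_sum_swap (all_count k l') c.+1 x h.
rewrite -addSn.
suff : \sum_(i < minn x h) nonneg_count k l' (h + x - i.+1.*2) (i.+1 + c) +
  \sum_(i < minn x h) all_count k l' (c.+1 + (x + h).-1 - i)
   = window_sum (all_count k l') c.+1 (minn x h) by lia.
rewrite -big_split; apply: eq_bigr => i _ /=.
have iM := ltn_ord i.
have -> : c.+1 + (x + h).-1 - i = i.+1 + c + (h + x - i.+1.*2).+1 by lia.
by rewrite reflection; [congr all_count; lia | lia].
Qed.

(** Every count is a difference of windows of [f] or [F], and a value of [F] is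
    itself a window of [f] of length y + 1. The term for i = 0 is a pair of
    windows of length y - m, empty when y <= m; the excluded paths for i > 0
    start at height m - y, which is 0 when m < y. In both cases additivity of
    windows cancels everything. *)
Lemma wrap_count :
  ends_count (fun i j s => [&& i + sumn s + j + r == k,
    valleys_ok (x :: rcons l y) (i :: rcons s j) m & wrap_choice i j s])
  + ends_count (fun i j s =>
      (i + sumn s + j + (m.+1 + r) == k) && ((0 < i) && (j < y)))
  = ends_count (fun i j s => (i + sumn s + j + r == k) && ((0 < i) && (j < y))).
Proof.
have A1 := wrap_peak_ends_count r; have B1 := wrap_peak_ends_count (m.+1 + r).
have C0 := first_run_empty_count.
have C1 := @reflection_sum (rcons l y) m r.
have C2 := @reflection_sum l (m - y) (y + r).
rewrite {1}/ends_count big_ord_recl.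
have CC : \sum_(i < x) \sum_(j < y.+1)
    count (fun s => [&& i.+1 + sumn s + j + r == k,
      valleys_ok (x :: rcons l y) (i.+1 :: rcons s j) m
      & wrap_choice i.+1 j s]) (choices l)
  + \sum_(i < x) (if i < m - y then
      nonneg_count k l (m - y + x - i.+1.*2) (i.+1 + (y + r)) else 0)
  = \sum_(i < x) (if i < m then
      nonneg_count k (rcons l y) (m + x - i.+1.*2) (i.+1 + r) else 0).
  rewrite -big_split; apply: eq_bigr => i _ /=; rewrite addnA.
  by rewrite -(@first_run_nonempty_count i.+1) //=; have := ltn_ord i.
have {}C1 := C1 _; have {}C2 := C2 _.
rewrite sumn_rcons in C1.
specialize (C1 ltac:(lia)); specialize (C2 ltac:(lia)).
rewrite -/f -/F in C1 C2.
set S0 := (S0 in S0 + _ + _); set S1 := (S1 in _ + S1 + _).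
have {}C0 : S0 + _ = _ := C0; have {}CC : S1 + _ = _ := CC.
set c := m.+1 + r in B1 C0 *.
(* The window of F of length x slides by one place. *)
have step : window_sum F c x + window_sum f (c + x) y.+1 =
            window_sum f c y.+1 + window_sum F c.+1 x.
  have Fy c' : window_sum f c' y.+1 = window_sum F c' 1.
    by rewrite /window_sum big_ord1 addn0 /F all_count_rcons.
  by rewrite !Fy -window_sumD addnC window_sumD addn1.
have E1 : (r + m).+1 = c by rewrite /c; lia.
have E2 : r + y.+1 = (y + r).+1 by lia.
rewrite E1 in C1; rewrite E2 in A1.
have [ym|my] := leqP y m.
  have E3 : (y + r + (m - y)).+1 = c by rewrite /c; lia.
  have E4 : y - m = 0 by lia.
  rewrite E3 in C2; rewrite E4 /window_sum !big_ord0 -!/(window_sum _ _ _) in C0.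
  have := window_sumD f c x y.+1; rewrite [x + _]addnC window_sumD; lia.
have E3 : (y + r + (m - y)).+1 = c + (y - m) by rewrite /c; lia.
have E4 : (y + r).+1 = c + (y - m) by rewrite /c; lia.
have E5 : y.+1 = y - m + m.+1 by lia.
rewrite E3 in C2; rewrite E4 in C2 A1; rewrite E5 !(addnA, window_sumD) in B1 step.
have := window_sumD f (c + (y - m)) x m.+1; rewrite [x + _]addnC window_sumD.
have -> : c + (y - m) + x = c + x + (y - m) by lia.
lia.
Qed.
End WrapCount.

(** * Words, peaks and block decompositions *)

Fixpoint peaks w :=
  if w is b :: w' then (~~ b && head false w') :: peaks w' else [::].

(** The letter [true] is a down step and [false] an up step. *)
Fixpoint stays w h :=
  if w is b :: w' then
    if b then (0 < h) && stays w' h.-1 else stays w' h.+1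
  else true.

(** Consecutive gaps are separated by a peak [false; true], so that any numbers
    of down steps in the gaps give a word with the same peaks. *)
Fixpoint block_word l s :=
  match l, s with
  | x :: l', i :: s' =>
      nseq i true ++ nseq (x - i) false ++
      (if l' is [::] then [::] else false :: true :: block_word l' s')
  | _, _ => [::]
  end.

Fixpoint peak_mask l :=
  if l is x :: l' then
    nseq x false ++
    (if l' is [::] then [::] else true :: false :: peak_mask l')
  else [::].

Lemma nth_peaks w p : nth false (peaks w) p = ~~ nth true w p && nth false w p.+1.
Proof. by elim: w p => [|b w IH] [|p] //=; rewrite nth0. Qed.

Lemma peaks_trues a w : peaks (nseq a true ++ w) = nseq a false ++ peaks w.
Proof. by elim: a => //= a ->. Qed.

Lemma peaks_falses b w : head false w = false ->
  peaks (nseq b false ++ w) = nseq b false ++ peaks w.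
Proof. by move=> hw; elim: b => //= -[|b] -> //=; rewrite hw. Qed.

Lemma peaks_block_word l s : s \in choices l ->
  peaks (block_word l s) = peak_mask l.
Proof.
rewrite mem_choices; elim: l s => [|x l IH] [|i s] //= /andP[ix /IH E].
rewrite peaks_trues peaks_falses; last by case: l {IH E}.
rewrite catA -nseqD subnKC //; by case: l E {IH} => //= y l ->.
Qed.

Lemma peak_mask_inj l l' : l != [::] -> l' != [::] ->
  peak_mask l = peak_mask l' -> l = l'.
Proof.
elim: l l' => [|x l IH] [|x' l'] //= _ _.
have body y (u : seq nat) :
  find id (nseq y false ++ if u is [::] then [::] else true :: false :: peak_mask u) = y.
  by rewrite find_cat has_nseq andbF size_nseq; case: u => [|? ?] /=; rewrite addn0.
move=> E; have xx : x = x' by rewrite -(body x l) E body.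
move: E; rewrite -{}xx => /eqP; rewrite eqseq_cat // eqxx /=.
case: l IH => [|y l] IH; case: l' => [|y' l'] //= /eqP[] E.
by rewrite (IH (y' :: l')).
Qed.

Lemma count_block_word l s : s \in choices l ->
  count id (block_word l s) = sumn s + (size l).-1.
Proof.
rewrite mem_choices; elim: l s => [|x l IH] [|i s] //= /andP[ix /IH E].
rewrite !count_cat !count_nseq /=.
case: l E {IH} => [|y l] E; first by case: s E => //=; lia.
by move: (block_word (y :: l) s) E => v /= ->; lia.
Qed.

Lemma size_block_word l s : s \in choices l ->
  size (block_word l s) = sumn l + 2 * (size l).-1.
Proof.
rewrite mem_choices; elim: l s => [|x l IH] [|i s] //= /andP[ix /IH E].
rewrite !size_cat !size_nseq.
case: l E {IH} => [|y l] E; first by case: s E => //=; lia.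
by move: (block_word (y :: l) s) E => v /= ->; lia.
Qed.

Lemma block_word_inj l : {in choices l &, injective (block_word l)}.
Proof.
move=> s s'; rewrite !mem_choices; elim: l s s' => [|x l IH] [|i s] [|i' s'] //=.
move=> /andP[ix Hs] /andP[ix' Hs'].
have body a v : find negb (nseq a true ++ nseq (x - a) false ++
  if l is [::] then [::] else false :: true :: v) = a.
  rewrite find_cat has_nseq andbF size_nseq.
  by case: (x - a) => [|?] /=; case: l {IH Hs Hs'} => //= *; rewrite addn0.
move=> E; have ii : i = i' by rewrite -(body i (block_word l s)) E body.
move: E; rewrite -{}ii => /eqP; rewrite !eqseq_cat // !eqxx /=.
case: l IH Hs Hs' {body} => [|y l] IH; first by case: s => //; case: s'.
by move=> Hs Hs' /eqP[] E; congr cons; apply: IH.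
Qed.

(** Adding a letter in front either lengthens the first gap or, for an up step
    before a down step, turns these two letters into a peak after an empty
    gap. *)
Lemma block_word_surj w : exists l s,
  [/\ l != [::], s \in choices l & w = block_word l s].
Proof.
elim: w => [|b w [l [s [l0 sl ->]]]]; first by exists [:: 0], [:: 0].
case: l s l0 sl => [|x l] [|i s] //; rewrite mem_choices //= => _ /andP[ix sl].
case: b.
  by exists (x.+1 :: l), (i.+1 :: s); rewrite mem_choices /= ltnS ix.
case: i ix => [|i] ix.
  by exists (x.+1 :: l), (0 :: s); rewrite mem_choices /= !subn0.
exists (0 :: x.-1 :: l), (0 :: i :: s); rewrite mem_choices /= sl andbT.
by split=> //; [lia | congr [:: _, _ & _ ++ nseq _ _ ++ _]; lia].
Qed.

Lemma stays_falses b w h : stays (nseq b false ++ w) h = stays w (h + b).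
Proof. by elim: b h => [|b IH] h; rewrite ?addn0 //= IH addSnnS. Qed.

Lemma stays_trues a w h : stays (nseq a true ++ w) h = (a <= h) && stays w (h - a).
Proof.
elim: a h => [|a IH] h; rewrite ?subn0 //= IH.
by case: h => [|h] //; rewrite subSS.
Qed.

(** A peak goes up before it goes down, so it creates no lower minimum than the
    valley before it. *)
Lemma stays_block_word l s h : s \in choices l ->
  stays (block_word l s) h = valleys_ok l s h.
Proof.
rewrite mem_choices; elim: l s h => [|x l IH] [|i s] h //= /andP[ix /IH E].
rewrite stays_trues stays_falses; congr andb.
by case: l E {IH} => [|y l] // E; rewrite -E.
Qed.

(** The condition on all prefixes is the one that compares with the entries of a
    tableau. *)
Lemma staysP w h :
  reflect (forall p, p <= size w ->
             count id (take p w) <= count negb (take p w) + h) (stays w h).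
Proof.
apply: (iffP idP).
  elim: w h => [|b w IH] h /= H [|p] //= pw.
  by case: b H => [/andP[h0]|] /IH /(_ _ pw) /=; lia.
elim: w h => [|b w IH] h //= H; case: b H => H.
  have := H 1 isT; rewrite /= take0 /= => h0.
  apply/andP; split; first lia.
  by apply: IH => p pw; have := H p.+1 pw => /=; lia.
by apply: IH => p pw; have := H p.+1 pw => /=; lia.
Qed.

(** The last peak and the last gap form the last run of down steps, one longer
    than the choice in that gap, followed by the final up steps. *)
Lemma block_word_rcons l y s j : s \in choices l -> l != [::] ->
  block_word (rcons l y) (rcons s j) =
  block_word l s ++ false :: nseq j.+1 true ++ nseq (y - j) false.
Proof.
rewrite mem_choices.
elim: l s => [|x l IH] [|i s] //= /andP[ix Hs] _; rewrite -!catA; do 2!congr cat.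
case: l s IH Hs => [|x' l] [|i' s] //= IH Hs; first by rewrite cats0.
by move: (IH (i' :: s) Hs isT) => /= ->.
Qed.

Definition words n : seq (seq bool) := [seq val t | t <- enum {: n.-tuple bool}].

Lemma mem_words n w : (w \in words n) = (size w == n).
Proof.
apply/mapP/eqP => [[t _ ->]|E]; first by rewrite size_tuple.
by exists (tcast E (in_tuple w)); rewrite ?mem_enum //= val_tcast.
Qed.

Lemma uniq_words n : uniq (words n).
Proof. by rewrite map_inj_uniq ?enum_uniq //; apply: val_inj. Qed.

Lemma count_words_peak_mask n l Q : l != [::] -> sumn l + 2 * (size l).-1 = n ->
  count (fun w => (peaks w == peak_mask l) && Q w) (words n) =
  count (fun s => Q (block_word l s)) (choices l).
Proof.
move=> l0 ln.
rewrite -[RHS](count_map (block_word l) Q).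
rewrite -[LHS](eq_count (a1 := predI Q (fun w => peaks w == peak_mask l))); last first.
  by move=> w /=; rewrite andbC.
rewrite -count_filter; apply/permP; apply: uniq_perm.
- exact: filter_uniq (uniq_words n).
- by rewrite map_inj_in_uniq ?uniq_choices //; apply: block_word_inj.
move=> w; rewrite mem_filter mem_words; apply/andP/mapP => [[/eqP pw /eqP sw]|[s sl ->]].
  have [l' [s [l0' sl E]]] := block_word_surj w.
  move: pw; rewrite E peaks_block_word // => /(peak_mask_inj l0' l0) El.
  by exists s; rewrite -?El.
by rewrite peaks_block_word // size_block_word // ln !eqxx.
Qed.

(** A statement about the words with a given peak mask needs a proof only for the
    masks of block words, apart from the case where no word has that mask. *)
Lemma peaks_words_ind n (P : seq bool -> Prop) :
  (forall M, count (fun w => peaks w == M) (words n) = 0 -> P M) ->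
  (forall l, l != [::] -> sumn l + 2 * (size l).-1 = n -> P (peak_mask l)) ->
  forall M, P M.
Proof.
move=> P0 Pl M; have [/P0//|] := posnP (count (fun w => peaks w == M) (words n)).
rewrite -has_count => /hasP[w]; rewrite mem_words => /eqP sw /eqP <-.
have [l [s [l0 sl E]]] := block_word_surj w.
by rewrite E peaks_block_word //; apply: Pl => //; rewrite -sw E size_block_word.
Qed.

(** * The wrap-around descent of a word *)

(** The word is read backwards to find its final up steps, [c] in number, its last
    run of [b.+1] down steps, and the part [w1] left of the up step before that
    run. The conditions (1)-(4) are then statements about heights along
    [w1]. *)
Definition wrap_descent m w :=
  let c := find id (rev w) in
  let v := drop c (rev w) in
  let b := (find negb v).-1 in
  let w1 := rev (drop b.+2 v) in
  if head false w then [|| 0 < c, m < b | ~~ stays w1 (m - b)]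
  else (m < b) && stays (behead (rcons w1 false)) 0.

Lemma wrap_descentE m w1 b c :
  wrap_descent m (w1 ++ false :: nseq b.+1 true ++ nseq c false) =
  if head false w1 then [|| 0 < c, m < b | ~~ stays w1 (m - b)]
  else (m < b) && stays (behead (rcons w1 false)) 0.
Proof.
have E : rev (w1 ++ false :: nseq b.+1 true ++ nseq c false) =
     nseq c false ++ nseq b.+1 true ++ false :: rev w1.
  by rewrite rev_cat rev_cons rev_cat !rev_nseq cat_rcons -catA.
rewrite /wrap_descent E find_cat has_nseq andbF size_nseq addn0.
rewrite drop_size_cat ?size_nseq //.
rewrite find_cat has_nseq andbF size_nseq addn0.
have -> : drop b.+1.-1.+2 (nseq b.+1 true ++ false :: rev w1) = rev w1.
  by rewrite -cat_rcons drop_size_cat ?size_rcons ?size_nseq.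
by rewrite revK; case: w1 E.
Qed.

Lemma stays_rcons w h : stays (rcons w false) h = stays w h.
Proof. by elim: w h => [|b w IH] h //=; rewrite !IH. Qed.

Definition wrap_peak w := head false w && ~~ last false w.

Lemma mem_choices_ends x l y i s j : i <= x -> j <= y -> s \in choices l ->
  i :: rcons s j \in choices (x :: rcons l y).
Proof.
rewrite !mem_choices /= => -> jy; elim: l s => [|x' l IH] [|i' s] //=.
  by rewrite jy.
by move=> /andP[-> /IH].
Qed.

(** For x = 0 and no middle gap the two sides differ in form: there the path is
    at height m when its last run begins its second step, so it cannot have
    j > m down steps left and stay nonnegative. *)
Lemma wrap_descent_block_word m x l y i s j : i <= x -> j <= y -> s \in choices l ->
  let w := block_word (x :: rcons l y) (i :: rcons s j) in
  stays w m && wrap_descent m w =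
  valleys_ok (x :: rcons l y) (i :: rcons s j) m && wrap_choice m x y l i j s.
Proof.
move=> ix jy sl w.
have sl0 : i :: s \in choices (x :: l).
  by move: sl; rewrite !mem_choices /= ix.
have sl1 := mem_choices_ends ix jy sl.
rewrite stays_block_word //; case ok: valleys_ok => //=.
rewrite /w -!rcons_cons block_word_rcons // wrap_descentE.
have -> : head false (block_word (x :: l) (i :: s)) = (0 < i).
  by rewrite /=; case: (i) => [|?] /=; [case: (x - 0) => [|?]; case: (l) | ].
rewrite stays_block_word //.
case: i ix ok sl0 {sl1 w} => [|i] ix ok sl0; last first.
  rewrite /wrap_choice subn_gt0; case: (ltnP m j) => //= mj.
  by have -> : m - j = 0 by lia; rewrite orbT.
rewrite ltnn /wrap_choice; case: (ltnP m j) => //= mj; rewrite subn0.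
case: x ix ok {sl0} => [|x] ix /=.
  by case: l s sl => [|x' l] [|i' s] //=; lia.
rewrite rcons_cat /= stays_falses add0n => _.
have := stays_block_word x sl.
case: l s sl => [|x' l] [|i' s] // _.
by move: (block_word _ _) => v <-; rewrite /= stays_rcons.
Qed.

Lemma wrap_peak_block_word x l y i s j : i <= x -> j <= y -> s \in choices l ->
  wrap_peak (block_word (x :: rcons l y) (i :: rcons s j)) = (0 < i) && (j < y).
Proof.
move=> ix jy sl.
have sl0 : i :: s \in choices (x :: l).
  by move: sl; rewrite !mem_choices /= ix.
rewrite -!rcons_cons block_word_rcons // /wrap_peak last_cat /=; congr andb.
  by case: (i) => [|?] //=; case: (x - 0) => [|?]; case: (l).
rewrite last_cat -(subn_gt0 j y); case: (y - j) => [|b] /=.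
  by elim: j {jy}.
by elim: b.
Qed.

Lemma wrap_peak_block_word1 x i : i <= x ->
  wrap_peak (block_word [:: x] [:: i]) = (0 < i < x).
Proof.
move=> ix; rewrite /= cats0 /wrap_peak last_cat -(subn_gt0 i x).
case: i ix => [|i] ix /=; first by case: (x - 0).
by case: (x - i.+1) => [|b] /=; [elim: i {ix} | elim: b].
Qed.

(** Without a peak the word would be a run of all its down steps followed by up
    steps, and would go below 0. *)
Lemma last_run w m : stays w m -> m < count id w ->
  exists w1 b c, w = w1 ++ false :: nseq b.+1 true ++ nseq c false.
Proof.
have [l [s [l0 sl ->]]] := block_word_surj w.
case: (lastP l) l0 sl => // {}l y _; case: (lastP s) => [|{}s j].
  by rewrite mem_choices; case: l.
move=> sl; have {}sl : s \in choices l /\ j <= y.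
  move: sl; rewrite !mem_choices; elim: l s => [|x l IH] [|i s] //=.
  - by rewrite andbT.
  - by case: s => [|? ?] /=; rewrite andbF.
  - by case: l {IH} => [|? ?] /=; rewrite andbF.
  - by move=> /andP[-> /IH].
case: sl => sl jy; case: l sl => [|x l].
  rewrite mem_choices; case: s => //= _; rewrite cats0.
  rewrite stays_trues count_cat !count_nseq; lia.
move=> sl _ _; rewrite block_word_rcons //.
by do 3!eexists.
Qed.

(** * Tableaux against all words *)

Section BallotWords.
Variables n k m : nat.
Hypotheses (hmk : m + 2 <= k) (hkn : k < n) (hnm : 2 * k <= n + m).

Let ballot w := (count id w == k) && stays w m.

(** Ordinary peaks only: the reflection principle from height m. *)
Lemma ballot_peaks_count M :
  count (fun w => (peaks w == M) && ballot w) (words n) +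
  count (fun w => (peaks w == M) && (count id w + m.+1 == k)) (words n) =
  count (fun w => (peaks w == M) && (count id w == k)) (words n).
Proof.
move: M; apply: (@peaks_words_ind n) => [M M0|l l0 ln].
  have Z Q : count (fun w => (peaks w == M) && Q w) (words n) = 0.
    apply/eqP; rewrite -leqn0 -M0; apply: sub_count => w /= /andP[] //.
  by rewrite !Z.
rewrite !count_words_peak_mask //.
transitivity (nonneg_count k l m (size l).-1 + all_count k l ((size l).-1 + m.+1)).
  congr (_ + _); apply: eq_in_count => s sl.
    by rewrite /ballot stays_block_word // count_block_word.
  by rewrite count_block_word // addnA.
rewrite reflection; last lia.
by apply: eq_in_count => s sl; rewrite count_block_word.
Qed.

(** A word without peaks consists of its down steps followed by its up steps. With
    k or with k-m-1 down steps it has a cyclic peak at its last letter, and with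
    k of them it goes below 0. With a peak, the first and last gaps are distinct
    and [wrap_count] applies. *)
Lemma ballot_wrap_count M :
  count (fun w => (peaks w == M) && (ballot w && wrap_descent m w)) (words n) +
  count (fun w => (peaks w == M) && ((count id w + m.+1 == k) && wrap_peak w)) (words n) =
  count (fun w => (peaks w == M) && ((count id w == k) && wrap_peak w)) (words n).
Proof.
move: M; apply: (@peaks_words_ind n) => [M M0|l l0 ln].
  have Z Q : count (fun w => (peaks w == M) && Q w) (words n) = 0.
    apply/eqP; rewrite -leqn0 -M0; apply: sub_count => w /= /andP[] //.
  by rewrite !Z.
rewrite !count_words_peak_mask //.
case: l l0 ln => [|x l] // _; case: (lastP l) => [|{}l y] ln.
  have {}ln : x = n by move: ln => /=; lia.
  have E c : c < n -> count (fun s => (sumn s == c) && wrap_peak (block_word [:: x] s))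
                       (choices [:: x]) = (0 < c).
    move=> cn; rewrite count_choices_cons.
    rewrite (eq_bigr (fun i : 'I_x.+1 => if i == c :> nat then 0 < c : nat else 0)).
      by rewrite -big_mkcond (big_ord1_eq addn (fun=> 0 < c : nat)) ln ltnS ltnW.
    move=> i _.
    rewrite -[LHS]/(((i + 0 == c) &&
                     wrap_peak (block_word [:: x] [:: i : nat])) + 0).
    rewrite (addn0 i) addn0 wrap_peak_block_word1 -1?ltnS //.
    by case: eqP => [->|//]; rewrite ln cn andbT.
  rewrite (eq_in_count (a2 := pred0)); last first.
    move=> s sl; rewrite /ballot count_block_word // stays_block_word //.
    by move: sl; rewrite mem_choices; case: s => [|i [|? ?]] /=; lia.
  rewrite count_pred0 add0n; transitivity (0 < k - m.+1 : nat);
    last transitivity (0 < k : nat).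
  - rewrite -E; last lia.
    by apply: eq_in_count => s sl; rewrite count_block_word //=; lia.
  - by lia.
  - rewrite -E //.
    by apply: eq_in_count => s sl; rewrite count_block_word //=; lia.
rewrite !count_choices_ends.
move: ln; rewrite /= sumn_rcons size_rcons => ln.
have long : 2 * k <= m + (x + sumn l + y) + 2 * (size l).+1 by lia.
have H := @wrap_count k m x y _ l long.
have E (Q Q' : nat -> nat -> pred (seq nat)) :
  (forall i j s, i <= x -> j <= y -> s \in choices l -> Q i j s = Q' i j s) ->
  ends_count x y l Q = ends_count x y l Q'.
  move=> QQ; apply: eq_bigr => i _; apply: eq_bigr => j _; apply: eq_in_count => s sl.
  by apply: QQ => //; rewrite -ltnS.
have C i j s : i <= x -> j <= y -> s \in choices l ->
   count id (block_word (x :: rcons l y) (i :: rcons s j)) = i + sumn s + j + (size l).+1.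
  move=> ix jy sl; rewrite count_block_word ?mem_choices_ends //=.
  by rewrite sumn_rcons size_rcons; lia.
etransitivity; last etransitivity; [|exact: H|].
  congr (_ + _); apply: E => i j s ix jy sl /=.
    by rewrite /ballot -andbA wrap_descent_block_word // C.
  by rewrite wrap_peak_block_word // C //; congr andb; lia.
by apply: E => i j s ix jy sl /=; rewrite wrap_peak_block_word // C.
Qed.

(** The refinement of the Jacobi-Trudi formula by cyclic descents. The words
    without a descent at the last letter are counted by difference. *)
Lemma ballot_perm_eq :
  perm_eq
    ([seq (peaks w, wrap_descent m w) | w <- words n & ballot w] ++
     [seq (peaks w, wrap_peak w) | w <- words n & count id w + m.+1 == k])
    [seq (peaks w, wrap_peak w) | w <- words n & count id w == k].
Proof.
apply/allP => -[M b] _ /=; apply/eqP.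
rewrite count_cat !count_map !count_filter.
have T := ballot_peaks_count M; have F := ballot_wrap_count M.
have S (F' B : pred (seq bool)) : 
  count (fun w => (peaks w == M) && (B w && F' w)) (words n) +
  count (predI (preim (fun w => (peaks w, F' w)) (pred1 (M, false))) B) (words n)
  = count (fun w => (peaks w == M) && B w) (words n).
  rewrite -[RHS]size_filter -[RHS](count_predC F') !count_filter.
  congr (_ + _); apply: eq_count => w /=; first by case: (F' w); rewrite ?andbT ?andbF.
  by rewrite xpair_eqE eqbF_neg; case: (_ == _); rewrite //= andbF.
have St (F' B : pred (seq bool)) : 
  count (predI (preim (fun w => (peaks w, F' w)) (pred1 (M, true))) B) (words n)
  = count (fun w => (peaks w == M) && (B w && F' w)) (words n).
  by apply: eq_count => w /=; rewrite xpair_eqE eqb_id; case: (_ == _); rewrite //= andbC.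
case: b; first by rewrite !St.
have /= S1 := S (wrap_descent m) ballot.
have /= S2 := S wrap_peak (fun w => count id w + m.+1 == k).
have /= S3 := S wrap_peak (fun w => count id w == k).
by move: S1 S2 S3 T F; rewrite /ballot /=; lia.
Qed.
End BallotWords.

(** * Two-row tableaux as ballot words *)

(** The enumeration of a set of integers in increasing order and its counting
    function determine each other; this turns inequalities between entries of a
    tableau into inequalities between numbers of letters. *)
Lemma nth_filter_iota (P : pred nat) n p q :
  q < count P (iota 0 n) -> p <= n ->
  (nth 0 (filter P (iota 0 n)) q < p) = (q < count P (iota 0 p)).
Proof.
move=> + pn; rewrite -(subnKC pn) iotaD count_cat filter_cat nth_cat.
rewrite size_filter add0n.
case: (ltnP q (count P (iota 0 p))) => [qp _|pq qn].
  have : nth 0 (filter P (iota 0 p)) q \in filter P (iota 0 p).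
    by rewrite mem_nth // size_filter.
  by rewrite mem_filter mem_iota => /andP[_]; lia.
have : nth 0 (filter P (iota p (n - p))) (q - count P (iota 0 p))
    \in filter P (iota p (n - p)).
  rewrite mem_nth // size_filter; move: qn pq; move: (count _ _) (count _ _); lia.
by rewrite mem_filter mem_iota => /andP[_]; lia.
Qed.

Lemma count_iota_take (a : pred bool) (w : seq bool) p : p <= size w ->
  count (fun e => a (nth false w e)) (iota 0 p) = count a (take p w).
Proof. by move=> pw; rewrite -(map_nth_iota0 false pw) count_map. Qed.

Lemma count_take_negb (w : seq bool) p : p <= size w ->
  count id (take p w) + count negb (take p w) = p.
Proof.
by move=> pw; rewrite -[RHS](size_takel pw) -(count_predC id).
Qed.

Section TwoRowTableaux.
Variables n k m : nat.
Hypotheses (hmk : m + 2 <= k) (hkn : k < n) (hnm : 2 * k <= n + m).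

Local Notation tab := (SYT2 n k m).
Local Notation cellT := (cell [:: n - k + m; k] [:: m]).
Local Notation cells := (skew_cells [:: n - k + m; k] [:: m]).

Lemma mem_cells i j :
  ((i, j) \in cells) =
  ((i == 1) && (m < j <= n - k + m)) || ((i == 2) && (0 < j <= k)).
Proof.
rewrite /skew_cells /= cats0 mem_cat.
have memp a r : ((i, j) \in [seq (a, j) | j <- r]) = (i == a) && (j \in r).
  apply/mapP/andP => [[j' jr [-> ->]]|[/eqP-> jr]] //.
  by exists j.
by rewrite !memp !mem_iota; congr (_ && _ || _ && _); lia.
Qed.

Lemma entry_val (T : tab) c : entry T (row c) (col c) = (val T c).+1.
Proof.
rewrite /entry /row /col.
have -> : insub ((val c).1, (val c).2) = Some c by rewrite -surjective_pairing valK.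
by [].
Qed.

Lemma tab_inj (T : tab) : injective (val T).
Proof.
move=> c d cd; have /and3P[/forallP/(_ (val T c))/cards1P[x] + _ _] := valP T.
move/setP => E; have := E c; have := E d.
by rewrite !inE cd eqxx => /esym/eqP -> /esym/eqP ->.
Qed.

Lemma row_of_val (T : tab) c : row_of T (val T c).+1 = row c.
Proof.
rewrite /row_of; case: pickP => [d|/(_ c)]; last by rewrite eqxx.
by rewrite eqSS => /eqP/val_inj/tab_inj ->.
Qed.

Lemma cell_of i j : (i, j) \in cells -> exists2 c : cellT, row c = i & col c = j.
Proof. by move=> H; exists (SeqSub H). Qed.

Lemma entryP (T : tab) i j : (i, j) \in cells ->
  0 < entry T i j <= n /\ row_of T (entry T i j) = i.
Proof.
by move=> /cell_of[c <- <-]; rewrite entry_val row_of_val ltn_ord.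
Qed.

Lemma entry_onto (T : tab) e : 0 < e <= n ->
  exists i j, (i, j) \in cells /\ entry T i j = e.
Proof.
case: e => // e en; have /and3P[/forallP/(_ (Ordinal en))/cards1P[c] + _ _] := valP T.
move/setP/(_ c); rewrite !inE eqxx => /eqP E.
exists (row c), (col c); rewrite entry_val E; split=> //.
by rewrite -surjective_pairing; apply: valP.
Qed.

Lemma entry_row (T : tab) i j j' : (i, j) \in cells -> (i, j') \in cells ->
  j < j' -> entry T i j < entry T i j'.
Proof.
move=> /cell_of[c <- <-] /cell_of[d rd <-] cd; rewrite -rd entry_val rd entry_val ltnS.
have /and3P[_ /forallP/(_ c)/forallP/(_ d) + _] := valP T.
by rewrite rd eqxx cd.
Qed.

Lemma entry_col (T : tab) j : (1, j) \in cells -> (2, j) \in cells ->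
  entry T 1 j < entry T 2 j.
Proof.
move=> /cell_of[c rc cc] /cell_of[d rd cd].
rewrite -{1}rc -{1}cc -rd -cd !entry_val ltnS.
have /and3P[_ _ /forallP/(_ c)/forallP/(_ d)] := valP T.
by rewrite rc rd cc cd eqxx.
Qed.

Lemma row_of_12 (T : tab) e : 0 < e <= n -> row_of T e = 1 \/ row_of T e = 2.
Proof.
move=> /(entry_onto T)[i [j [H <-]]]; have [_ ->] := entryP T H.
by move: H; rewrite mem_cells; lia.
Qed.

Definition word_of (T : tab) := [seq row_of T e.+1 == 2 | e <- iota 0 n].

Lemma size_word_of T : size (word_of T) = n.
Proof. by rewrite size_map size_iota. Qed.

Lemma nth_word_of T x0 p : p < n -> nth x0 (word_of T) p = (row_of T p.+1 == 2).
Proof. by move=> pn; rewrite (nth_map 0) ?size_iota // nth_iota. Qed.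

(** Both lists are strictly increasing and have the same elements. The offset
    [o] is m in the first row and 0 in the second. *)
Lemma row_entries T i o K (a : pred bool) :
  (forall j, ((i, j) \in cells) = (o < j <= o + K)) ->
  (forall e, e < n -> a (nth false (word_of T) e) = (row_of T e.+1 == i)) ->
  [seq (entry T i (o + j.+1)).-1 | j <- iota 0 K] =
  [seq e <- iota 0 n | a (nth false (word_of T) e)].
Proof.
move=> cE aE.
have cI j : j < K -> (i, o + j.+1) \in cells by rewrite cE; lia.
apply: (irr_sorted_eq ltn_trans ltnn).
- apply: (@homo_sorted_in _ _ (gtn K) _ ltn).
  + move=> j j' jK j'K jj'.
    have := entry_row T (cI _ jK) (cI _ j'K).
    have [+ _] := entryP T (cI _ jK).
    by lia.
  + by apply/allP => j; rewrite mem_iota.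
  + exact: iota_ltn_sorted.
- exact: sorted_filter ltn_trans _ _ (iota_ltn_sorted 0 n).
move=> e; rewrite mem_filter mem_iota; apply/mapP/andP.
  move=> [j]; rewrite mem_iota => jK ->.
  have [H1 H2] := entryP T (cI j jK).
  by rewrite aE ?prednK ?H2 ?eqxx; lia.
move=> [+ en]; rewrite aE // => /eqP re.
have [i' [j [ij E]]] := @entry_onto T e.+1 en.
have [_ H] := entryP T ij; rewrite E re in H; subst i'.
move: (ij); rewrite cE => jK; exists (j - o).-1; first by rewrite mem_iota; lia.
by rewrite (_ : o + (j - o).-1.+1 = j) ?E; last lia.
Qed.

Lemma entry_leq T i o K (a : pred bool) j p :
  (forall j, ((i, j) \in cells) = (o < j <= o + K)) ->
  (forall e, e < n -> a (nth false (word_of T) e) = (row_of T e.+1 == i)) ->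
  0 < j <= K -> p <= n ->
  (entry T i (o + j) <= p) = (j <= count a (take p (word_of T))).
Proof.
move=> cE aE; case: j => // j jK pn.
have E := row_entries cE aE.
have := @nth_filter_iota (fun e => a (nth false (word_of T) e)) n p j.
rewrite -size_filter -E size_map size_iota => /(_ jK pn).
rewrite (nth_map 0) ?size_iota // nth_iota // count_iota_take ?size_word_of //.
have ij : (i, o + j.+1) \in cells by rewrite cE; lia.
have [/andP[+ _] _] := entryP T ij.
by move=> + <-; rewrite add0n; case: (entry _ _ _).
Qed.

Lemma entry2_leq T j p : 0 < j <= k -> p <= n ->
  (entry T 2 j <= p) = (j <= count id (take p (word_of T))).
Proof.
move=> jk pn; rewrite -(@entry_leq T 2 0 k id) // => [j'|e en].
  by rewrite mem_cells.
by rewrite nth_word_of.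
Qed.

Lemma entry1_leq T j p : 0 < j <= n - k -> p <= n ->
  (entry T 1 (m + j) <= p) = (j <= count negb (take p (word_of T))).
Proof.
move=> jk pn; rewrite -(@entry_leq T 1 m (n - k) negb) // => [j'|e en].
  by rewrite mem_cells; lia.
by rewrite nth_word_of //; have [->|->] := @row_of_12 T e.+1 en.
Qed.

Lemma count_word_of T : count id (word_of T) = k.
Proof.
rewrite -{1}(take_size (word_of T)) -count_iota_take // size_word_of -size_filter.
rewrite -(@row_entries T 2 0 k id) => [|j|e en]; first by rewrite size_map size_iota.
  by rewrite mem_cells.
by rewrite nth_word_of.
Qed.

(** If a prefix has c > m down steps, the entry in column c of the second row lies
    in it, and so does the smaller entry above it, which is the up step of rank
    c - m. *)
Lemma stays_word_of T : stays (word_of T) m.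
Proof.
apply/staysP => p; rewrite size_word_of => pn.
set c := count id _; case: (leqP c m) => [|mc]; first lia.
have ck : c <= k.
  rewrite -(count_word_of T) -(cat_take_drop p (word_of T)).
  by rewrite count_cat leq_addr.
have c2 : entry T 2 c <= p by rewrite entry2_leq //; lia.
have c12 : entry T 1 c < entry T 2 c by apply: entry_col; rewrite mem_cells; lia.
have : entry T 1 (m + (c - m)) <= p by rewrite subnKC; lia.
by rewrite entry1_leq //; lia.
Qed.

(** The letter counts of the prefixes determine every entry. *)
Lemma word_of_inj : injective word_of.
Proof.
move=> T T' E; apply/val_inj/ffunP => c; apply/val_inj/eq_add_S; rewrite -!entry_val.
have leq_ext a b : a <= n -> b <= n -> (forall p, p <= n -> (a <= p) = (b <= p)) -> a = b.
  by move=> an bn H; have := H a an; have := H b bn; lia.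
have cc : (row c, col c) \in cells by rewrite -surjective_pairing; apply: valP.
have [/andP[_ H] _] := entryP T cc; have [/andP[_ H'] _] := entryP T' cc.
apply: leq_ext => // p pn; clear H H'.
move: cc; rewrite mem_cells => /orP[] /andP[/eqP-> cc]; last by rewrite !entry2_leq // E.
have -> : col c = m + (col c - m) by lia.
by rewrite !entry1_leq ?E //; lia.
Qed.

Lemma card_cells : #|{: cellT}| = n.
Proof.
rewrite card_seq_sub ?size_skew_cells2 //; first exact: ltnW.
rewrite /skew_cells /= cats0 cat_uniq.
rewrite !map_inj_uniq ?iota_uniq; try by move=> ? ? [].
rewrite andbT; apply/hasPn => -[i j] /mapP[j' _ [-> _]].
by apply/mapP => -[? _ []].
Qed.

(** The cell of rank j in its row receives the position of the j-th letter of the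
    corresponding kind. Rows increase by construction; columns increase because
    the path stays nonnegative at the prefix that ends with the lower entry. *)
Lemma word_of_onto w : size w = n -> count id w = k -> stays w m ->
  exists T, word_of T = w.
Proof.
move=> sw cw /staysP ok; rewrite sw in ok.
have n0 : 0 < n by lia.
pose pos (b : bool) := [seq e <- iota 0 n | nth false w e == b].
pose idx (c : cellT) := if row c == 2 then (col c).-1 else (col c - m).-1.
pose g (c : cellT) := nth 0 (pos (row c == 2)) (idx c).
have size_pos b : size (pos b) = if b then k else n - k.
  rewrite size_filter (count_iota_take (pred1 b)) ?sw // take_oversize ?sw //.
  have := count_predC id w; rewrite cw sw.
  case: b => [_|<-]; first by rewrite -cw; apply: eq_count => -[].
  by rewrite addKn; apply: eq_count => -[].
have cellE (c : cellT) : (row c, col c) \in cells.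
  by rewrite -surjective_pairing; apply: valP.
have idx_lt c : idx c < size (pos (row c == 2)).
  rewrite size_pos /idx; have := cellE c; rewrite mem_cells.
  by case: (row c =P 2) => [->|_]; lia.
have g_in c : g c \in pos (row c == 2) by rewrite mem_nth.
have g_lt c : g c < n by have := g_in c; rewrite mem_filter mem_iota => /andP[].
have g_nth c : nth false w (g c) = (row c == 2).
  by have := g_in c; rewrite mem_filter => /andP[/eqP].
have pos_sorted b : sorted ltn (pos b).
  exact: sorted_filter ltn_trans _ _ (iota_ltn_sorted 0 n).
have g_inj : injective g.
  move=> c d cd; have rcd : (row c == 2) = (row d == 2) by rewrite -!g_nth cd.
  have /eqP : g c = g d by []. 
  rewrite /g rcd nth_uniq -?rcd ?idx_lt //; last 2 first.
  - by rewrite rcd idx_lt.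
  - exact: sorted_uniq ltn_trans ltnn _ (pos_sorted _).
  move=> /eqP; rewrite /idx -rcd.
  have := cellE c; have := cellE d; rewrite !mem_cells => Hd Hc Hi.
  apply/val_inj; rewrite (surjective_pairing (val c)) (surjective_pairing (val d)).
  rewrite -/(row c) -/(row d) -/(col c) -/(col d).
  by move: rcd Hi Hc Hd; case: (row c =P 2); case: (row d =P 2) => *; congr (_, _); lia.
pose f := [ffun c => Ordinal (g_lt c)].
have fE c : f c = g c :> nat by rewrite ffunE.
have f_inj : injective f by move=> c d cd; apply: g_inj; rewrite -!fE cd.
have std : is_standard f.
  apply/and3P; split.
  - apply/forallP => e; apply/cards1P.
    have /codomP[c ->] : e \in codom f.
      by apply: inj_card_onto; rewrite ?card_ord ?card_cells.
    by exists c; apply/setP => d; rewrite !inE (inj_eq f_inj).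
  - apply/forallP => c; apply/forallP => d; apply/implyP => /andP[/eqP rcd cd].
    rewrite !fE /g rcd; apply: (sorted_ltn_nth ltn_trans _ (pos_sorted _)).
    + by rewrite inE -rcd idx_lt.
    + exact: idx_lt.
    + by move: (cellE c); rewrite /idx rcd mem_cells; case: (row d =P 2); lia.
  - apply/forallP => c; apply/forallP => d; apply/implyP => /andP[/eqP ccd rcd].
    have [rc rd] : row c = 1 /\ row d = 2.
      by move: (cellE c) (cellE d); rewrite !mem_cells; lia.
    rewrite !fE.
    have count_pos (b : bool) p : p <= n -> count (pred1 b) (take p w) =
                         count (fun e => nth false w e == b) (iota 0 p).
      by move=> pn; rewrite (count_iota_take (pred1 b)) // sw.
    have leq_pos b q p : q < size (pos b) -> p <= n ->
        (nth 0 (pos b) q < p) = (q < count (pred1 b) (take p w)).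
      by rewrite size_filter => qb pn; rewrite nth_filter_iota // count_pos.
    have gd1 := g_lt d.
    have Id : idx d < size (pos true) by have := idx_lt d; rewrite rd.
    have Ic : idx c < size (pos false) by have := idx_lt c; rewrite rc.
    have gE : (g c = nth 0 (pos false) (idx c)) * (g d = nth 0 (pos true) (idx d)).
      by rewrite /g rc rd.
    (* Comparison at the prefix that ends with the entry of d. *)
    have Hd : idx d < count (pred1 true) (take (g d).+1 w).
      by rewrite -leq_pos // -gE.2.
    have Hc : idx c < count (pred1 false) (take (g d).+1 w).
      move: Hd (ok _ gd1) (cellE c).
      rewrite (eq_count (a1 := pred1 true) (a2 := id)) => [|[]] //.
      rewrite (eq_count (a2 := negb) (a1 := pred1 false)) => [|[]] //.
      by rewrite mem_cells /idx rc rd ccd /=; lia.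
    have Hcd : g c < (g d).+1.
      by rewrite gE.1 leq_pos.
    rewrite ltn_neqAle -ltnS Hcd andbT; apply/eqP => E.
    by have := g_nth c; rewrite E g_nth rc rd.
exists (Sub f std); apply: (@eq_from_nth _ false); rewrite size_word_of ?sw // => p pn.
rewrite nth_word_of //.
have /codomP[c Ec] : Ordinal pn \in codom f.
  by apply: inj_card_onto; rewrite ?card_ord ?card_cells.
have /(congr1 val) /= Ep := Ec; rewrite ffunE /= in Ep.
have := row_of_val (Sub f std) c; rewrite [val _]SubK -Ec /= => ->.
by rewrite Ep g_nth.
Qed.

Lemma word_of_perm_eq :
  perm_eq [seq word_of T | T : tab]
          [seq w <- words n | (count id w == k) && stays w m].
Proof.
apply: uniq_perm.
- by rewrite map_inj_uniq ?enum_uniq //; apply: word_of_inj.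
- exact: filter_uniq (uniq_words n).
move=> w; rewrite mem_filter mem_words; apply/mapP/andP => [[T _ ->]|].
  by rewrite count_word_of stays_word_of size_word_of !eqxx.
move=> [/andP[/eqP cw ok] /eqP sw]; have [T <-] := word_of_onto sw cw ok.
by exists T; rewrite ?mem_enum.
Qed.

(** * The four conditions read on the word *)

Section LastRun.
Variables (T : tab) (w1 : seq bool) (b c : nat).
Let w := word_of T.
Hypothesis wE : w = w1 ++ false :: nseq b.+1 true ++ nseq c false.

Let downs p := count id (take p w).
Let ups p := count negb (take p w).
Let q := size w1.

Let sw : size w = n. Proof. exact: size_word_of. Qed.

Let downsDups p : p <= n -> downs p + ups p = p.
Proof. by move=> pn; apply: count_take_negb; rewrite sw. Qed.

Let nE : n = q + b + c + 2.
Proof. by rewrite -sw wE size_cat /= size_cat !size_nseq -/q; lia. Qed.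

Let take_prefix p : p <= q -> take p w = take p w1.
Proof. by move=> pq; rewrite wE takel_cat. Qed.

Let downs_run (s : nat) : s <= b.+1 -> downs (q + s).+1 = downs q + s.
Proof.
move=> sb; rewrite /downs wE -cat_rcons -addSn -(size_rcons w1 false).
rewrite takeD take_size_cat // drop_size_cat // takel_cat ?size_nseq //.
rewrite take_nseq // count_cat count_nseq mul1n -cats1 count_cat addn0.
by rewrite -catA take_size_cat.
Qed.

Let kE : k = downs q + b.+1.
Proof.
rewrite -(count_word_of T) -/w {1}wE count_cat /= count_cat !count_nseq.
by rewrite /downs take_prefix // /q take_size; lia.
Qed.

Let downs_mono p p' : p <= p' -> downs p <= downs p'.
Proof.
by move=> /subnKC <-; rewrite /downs takeD count_cat leq_addr.
Qed.

Let ups_mono p p' : p <= p' -> ups p <= ups p'.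
Proof.
by move=> /subnKC <-; rewrite /ups takeD count_cat leq_addr.
Qed.

Let entry2_leq' j p : 0 < j <= k -> p <= n -> (entry T 2 j <= p) = (j <= downs p).
Proof. exact: entry2_leq. Qed.

Let entry1_leq' j p : 0 < j <= n - k -> p <= n -> (entry T 1 (m + j) <= p) = (j <= ups p).
Proof. exact: entry1_leq. Qed.

Let entry2_le j : 0 < j <= k -> entry T 2 j <= n.
Proof.
by move=> jk; have [|/andP[]] := @entryP T 2 j _; first by rewrite mem_cells.
Qed.

(** The entries of the second row that end it are the positions of the last run,
    and the position before that run is an up step. *)
Lemma b_ofE : b_of T = b.
Proof.
have bk : b < k by lia.
apply/eqP; rewrite eqn_leq; apply/andP; split.
  apply/bigmax_leqP => b' /forallP H; rewrite leqNgt; apply/negP => bb'.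
  have b'k := ltn_ord b'.
  (* A longer run would put an entry of the second row at the position of
     the up step that precedes the last run. *)
  have bb : b.+1 < b'.+1 by [].
  have /eqP := H (Ordinal bb); have /eqP := H (Ordinal (ltn0Sn b')).
  rewrite /= => _ E.
  have E1 := @entry2_leq' k (q + b.+1) _ _; have E2 := @entry2_leq' (k - b.+1) q _ _.
  have := @downs_run b; rewrite addnS in E1.
  move: E1 E2 => /(_ ltac:(lia) ltac:(lia)) E1 /(_ ltac:(lia) ltac:(lia)) E2.
  by move=> /(_ ltac:(lia)) E3; lia.
rewrite /b_of (bigmax_sup (Ordinal bk)) //; apply/forallP => t /=; apply/eqP.
have tb : t <= b by rewrite -ltnS.
have pos (s : nat) : s <= b -> entry T 2 (k - s) = q + (b - s) + 2.
  move=> sb; have E1 := @entry2_leq' (k - s) (q + (b.+1 - s)).+1 _ _.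
  have E2 := @entry2_leq' (k - s) (q + (b - s)).+1 _ _.
  have A1 := @downs_run (b.+1 - s) _; have A2 := @downs_run (b - s) _.
  move: A1 A2 => /(_ ltac:(lia)) A1 /(_ ltac:(lia)) A2.
  by move: E1 E2 => /(_ ltac:(lia) ltac:(lia)) E1 /(_ ltac:(lia) ltac:(lia)) E2; lia.
have P0 := pos 0 (leq0n _); rewrite subn0 in P0.
by rewrite pos // P0 subn0 addnAC -(addnA q) subnK.
Qed.

Lemma first_row_of : (row_of T 1 == 2) = head false w1.
Proof.
rewrite -(@nth_word_of T false 0) -/w ?wE; last lia.
by case: (w1).
Qed.

Lemma cond1E : cond1 T = head false w1 && (0 < c).
Proof.
rewrite /cond1 /lower -first_row_of.
have : (row_of T n == 2) = (c == 0).
  have n0 : 0 < n by lia.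
  have := @nth_word_of T false n.-1; rewrite prednK // => <- //.
  rewrite -/w -sw nth_last wE last_cat /= last_cat; case: (c) => [|c'] /=.
    by elim: (b).
  by elim: c'.
have := @row_of_12 T n; have := @row_of_12 T 1.
by move=> /(_ ltac:(lia)) [] -> /(_ ltac:(lia)) [] ->; lia.
Qed.

(** The inequality T_(2,i) < T_(1,i+b) says that at the i-th down step the path is
    below height b. The range of i keeps both cells in the shape: its upper end
    excludes the last run, and below its lower end the path cannot yet have
    come below b. *)
Lemma cond4E : b <= m ->
  [exists i : 'I_k, (m - b + 1 <= i <= k - b - 1) && (entry T 2 i < entry T 1 (i + b))]
  = ~~ stays w1 (m - b).
Proof.
move=> bm; apply/idP/idP => [/existsP[i /andP[ib lt]]|].
  have ik := ltn_ord i.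
  have pn : entry T 2 i <= n by apply: entry2_le; lia.
  apply/staysP => /(_ (entry T 2 i)).
  have E1 := @entry2_leq' i (entry T 2 i) _ pn.
  have E2 := @entry2_leq' i q _ _.
  have E3 := @entry1_leq' (i + b - m) (entry T 2 i) _ pn.
  rewrite subnKC in E3; last lia.
  move: E1 E2 E3 => /(_ ltac:(lia)) E1 /(_ ltac:(lia) ltac:(lia)) E2 /(_ ltac:(lia)) E3.
  have pq : entry T 2 i <= q by rewrite E2; lia.
  by rewrite -take_prefix // -/(downs _) -/(ups _) => /(_ pq); lia.
apply: contraR => /existsPn H; apply/staysP => p pq.
rewrite -take_prefix // -/(downs _) -/(ups _) leqNgt; apply/negP => lt.
have Apq : downs p <= downs q := downs_mono pq.
(* The least number of down steps that puts a prefix with the up steps of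
   this one below height b. *)
have ik : ups p + (m - b) + 1 < k by lia.
have := H (Ordinal ik); rewrite /= negb_and => /orP[|]; first by lia.
have E1 := @entry2_leq' (ups p + (m - b) + 1) p _ _.
have E3 := @entry1_leq' (ups p).+1 p _ _.
move: E1 E3 => /(_ ltac:(lia) ltac:(lia)) E1 /(_ ltac:(lia) ltac:(lia)) E3.
have -> : ups p + (m - b) + 1 + b = m + (ups p).+1 by lia.
by lia.
Qed.

(** The inequality T_(2,i) > T_(1,i+m+1) says that after its i-th down step the
    path is above m, that is, at least at its height after the first letter. *)
Lemma cond2E : head false w1 = false -> m < b ->
  [forall i : 'I_k, (1 <= i <= k - b_of T - 1) ==>
         (entry T 2 i > entry T 1 (i + m + 1))]
  = stays (behead (rcons w1 false)) 0.
Proof.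
move=> hw mb; rewrite b_ofE.
have B1 : ups 1 = 1.
  have := @downsDups 1 ltac:(lia); have -> : downs 1 = 0; last by lia.
  by rewrite /downs wE; case: (w1) hw => [|? ?] //= ->; rewrite take0.
have shifted p : p <= q -> count id (take p (behead (rcons w1 false))) = downs p.+1
         /\ count negb (take p (behead (rcons w1 false))) = ups p.+1 - 1.
  move=> pq; rewrite /downs /ups wE -cat_rcons takel_cat ?size_rcons //.
  by case: (w1) hw => [_|x v /= ->]; rewrite /= ?add0n ?add1n ?subn1.
have sb : size (behead (rcons w1 false)) = q by rewrite size_behead size_rcons.
apply/forallP/staysP; rewrite ?sb => H.
  move=> p pq; have [-> ->] := shifted p pq; rewrite addn0.
  have Ap := @downs_mono p.+1 q.+1 pq; have Aq := @downs_run 0 isT; rewrite addn0 in Aq.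
  have Bp := @ups_mono 1 p.+1 isT.
  case: (posnP (downs p.+1)) => [->//|A0].
  have ik : downs p.+1 < k by lia.
  have := H (Ordinal ik); rewrite /= => /implyP/(_ ltac:(lia)) lt.
  have E1 := @entry2_leq' (downs p.+1) p.+1 _ _.
  have E3 := @entry1_leq' (downs p.+1).+1 p.+1 _ _.
  move: E1 E3 => /(_ ltac:(lia) ltac:(lia)) E1 /(_ ltac:(lia) ltac:(lia)).
  have <- : downs p.+1 + m + 1 = m + (downs p.+1).+1 by lia.
  by lia.
move=> i; apply/implyP => ib; have ik := ltn_ord i.
have E2 := @entry2_leq' i q _ _.
have {}E2 := E2 ltac:(lia) ltac:(lia).
have pn : entry T 2 i <= n by apply: entry2_le; lia.
have E1 := @entry2_leq' i (entry T 2 i) ltac:(lia) pn.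
have E3 := @entry1_leq' i.+1 (entry T 2 i) ltac:(lia) pn.
have c2 : (2, i : nat) \in cells by rewrite mem_cells; lia.
have c1 : (1, i + m + 1) \in cells by rewrite mem_cells; lia.
have [e2 r2] := @entryP T _ _ c2.
have [e1 r1] := @entryP T _ _ c1.
rewrite ltn_neqAle; apply/andP; split.
  by apply/eqP => E; rewrite E r2 in r1.
have -> : i + m + 1 = m + i.+1 by lia.
rewrite E3; have pq : (entry T 2 i).-1 <= q by lia.
have := H _ pq; have [-> ->] := shifted _ pq.
rewrite prednK; last by case/andP: e2.
by lia.
Qed.

Lemma wrap_descent_word_of : [|| cond1 T, cond2 T, cond3 T | cond4 T] = wrap_descent m w.
Proof.
rewrite wE wrap_descentE cond1E /cond2 /cond3 /cond4.
have -> : (row_of T 1 == 1) = ~~ head false w1.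
  by rewrite -first_row_of; have [->|->] := @row_of_12 T 1 ltac:(lia).
rewrite first_row_of b_ofE.
case hw: (head false w1) => /=; last first.
  rewrite !orbF; case: (ltnP m b) => //= mb.
  by have := cond2E hw mb; rewrite b_ofE.
congr orb; case: (ltnP m b) => //= mb.
by rewrite cond4E.
Qed.
End LastRun.
End TwoRowTableaux.

(** * Rotation of words *)

(** The mask gives the ordinary descents and the flag the status of n, the form in
    which [ballot_perm_eq] counts them. *)
Definition descent_set n (d : seq bool * bool) : {set 'I_n} :=
  [set i : 'I_n | nth false d.1 i || (i.+1 == n) && d.2].

Definition cyclic_peaks n w := descent_set n (peaks w, wrap_peak w).

(** Whether n belongs to the set follows the rule for the other letters, with the
    first letter taken as the successor of the last. *)
Lemma cyclic_peaks_ordS n w (i : 'I_n) : size w = n ->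
  (i \in cyclic_peaks n w) = ~~ nth false w i && nth false w (ordS i).
Proof.
move=> sw; rewrite inE /= nth_peaks (set_nth_default false) ?sw //.
have := ltn_ord i; rewrite leq_eqVlt => /orP[/eqP E|iS].
  rewrite E modnn eqxx [nth _ _ n]nth_default ?sw // andbF /= /wrap_peak.
  by rewrite -nth0 -nth_last sw -[in n.-1]E andbC.
by rewrite modn_small // (ltn_eqF iS) orbF.
Qed.

Lemma nth_rotr1_ordS n w (i : 'I_n) : size w = n ->
  nth false (rotr 1 w) (ordS i) = nth false w i.
Proof.
case/lastP: w => [|w b] sw; first by case: i => i; rewrite -sw.
rewrite size_rcons in sw; rewrite rotr1_rcons nth_rcons [nat_of_ord (ordS i)]/=.
have := ltn_ord i; rewrite leq_eqVlt => /orP[/eqP E|iS].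
  have -> : nat_of_ord i = size w by lia.
  by rewrite ltnn eqxx sw modnn.
have iw : i < size w by lia.
by rewrite modn_small // iw.
Qed.

Lemma cyclic_peaks_rotr n w : size w = n ->
  cyclic_peaks n (rotr 1 w) = shift (cyclic_peaks n w).
Proof.
move=> sw; apply/setP => i; rewrite -[i]ord_predK.
rewrite mem_imset; last exact: ordS_inj.
by rewrite !cyclic_peaks_ordS ?size_rotr // !nth_rotr1_ordS.
Qed.

Lemma words_rotr n (P : pred nat) :
  perm_eq [seq rotr 1 w | w <- words n & P (count id w)]
          [seq w <- words n | P (count id w)].
Proof.
apply: uniq_perm; rewrite ?filter_uniq ?uniq_words //.
  by rewrite map_inj_uniq ?filter_uniq ?uniq_words //; apply: rotr_inj.
have cr w : count id (rotr 1 w) = count id w.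
  by apply/permP; rewrite perm_rotr.
move=> w; apply/mapP/idP => [[v + ->]|].
  by rewrite !mem_filter !mem_words cr size_rotr.
rewrite mem_filter mem_words => H; exists (rot 1 w); last by rewrite rotK.
by rewrite mem_filter mem_words size_rot -cr rotK.
Qed.

Lemma cyclic_peaks_shift n (P : pred nat) :
  let L := [seq cyclic_peaks n w | w <- words n & P (count id w)] in
  perm_eq L [seq shift D | D <- L].
Proof.
rewrite /= -map_comp /comp.
have -> : [seq shift (cyclic_peaks n w) | w <- words n & P (count id w)] =
  [seq cyclic_peaks n w | w <- [seq rotr 1 w | w <- words n & P (count id w)]].
  rewrite -map_comp; apply/eq_in_map => w.
  rewrite mem_filter mem_words => /andP[_ /eqP sw].
  by rewrite /= cyclic_peaks_rotr.
by rewrite perm_sym; apply: perm_map; apply: words_rotr.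
Qed.

(** * The cyclic descent map *)

Lemma cDesP_word n k m (hmk : m + 2 <= k) (hkn : k < n) (hnm : 2 * k <= n + m)
   (T : SYT2 n k m) :
  cDesP T = descent_set n (peaks (word_of T), wrap_descent m (word_of T)).
Proof.
have [||w1 [b [c wE]]] := @last_run (word_of T) m.
- exact: stays_word_of.
- by rewrite count_word_of //; lia.
rewrite -(wrap_descent_word_of hmk hkn hnm wE).
apply/setP => i; rewrite !inE /=; congr orb.
rewrite nth_peaks /lower nth_word_of //.
case: (ltnP i.+1 n) => /= [iS|ni]; last first.
  by rewrite [nth _ _ i.+1]nth_default ?size_word_of // andbF.
rewrite nth_word_of //.
have [->|->] := @row_of_12 n k m hmk hkn hnm T i.+1 (ltn_ord i);
  by have [->|->] := @row_of_12 n k m hmk hkn hnm T i.+2 iS.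
Qed.

Theorem theorem6p7 (n k m : nat)
  (hmk : 2 <= m + 2 <= k) (hkn : k < n) (hnm : 2 * k <= n + m) :
  cyclic_descent_map (@cDesP n k m).
Proof.
have {}hmk : m + 2 <= k by case/andP: hmk.
split=> [T|].
  apply/setP => i; rewrite !inE; case: (ltnP i.+1 n) => /= [iS|_]; last by rewrite andbF.
  by rewrite (ltn_eqF iS) andbT orbF.
have base : perm_eq
   ([seq cDesP T | T : SYT2 n k m] ++
    [seq cyclic_peaks n w | w <- words n & count id w + m.+1 == k])
   [seq cyclic_peaks n w | w <- words n & count id w == k].
  have := perm_map (@descent_set n) (ballot_perm_eq hmk hkn hnm).
  rewrite map_cat -!map_comp; apply: perm_trans.
  rewrite perm_cat2r.
  have -> : [seq cDesP T | T : SYT2 n k m] =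
      [seq descent_set n (peaks w, wrap_descent m w)
         | w <- [seq word_of T | T : SYT2 n k m]].
    by rewrite -map_comp; apply: eq_map => S; apply: cDesP_word.
  by apply: perm_map; apply: word_of_perm_eq.
have sh := perm_map (@shift n) base.
rewrite map_cat in sh.
have shA := cyclic_peaks_shift n (fun c => c + m.+1 == k).
have shB := cyclic_peaks_shift n (fun c => c == k).
pose X := [seq cDesP T | T : SYT2 n k m].
pose Y := [seq cyclic_peaks n w | w <- words n & count id w + m.+1 == k].
suff XE : perm_eq X [seq shift D | D <- X] by move: XE; rewrite /X -map_comp.
(* The shift of the identity [base] differs from it only in the tableaux, so
   the words cancel. *)
rewrite -(perm_cat2r Y); apply: perm_trans base _; apply: perm_trans shB _.
by rewrite perm_sym; apply: perm_trans _ sh; rewrite perm_cat2l; apply: shA.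
Qed.
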